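(* Let $X$ be a Tychonoff space, and let $H$ be a subspace of $B(X)$ containing $B_1^{st}(X)$. Then the following assertions are equivalent: (i) $H$ is a Fréchet–Urysohn space; (ii) $H$ is a sequential space; (iii) $H$ is a $k$-space; (iv) $H$ has countable tightness; (v) $X_{\aleph_0}$ satisfies the property $\gamma$.
   Context: $B_0(X)=C(X)$ is the set of continuous functions $X\to\mathbb R$; for a nonzero countable ordinal $\alpha$, $B_\alpha(X)$ is the set of functions $X\to\mathbb R$ that are pointwise limits of sequences from $\bigcup_{\beta<\alpha}B_\beta(X)$; $B(X)=\bigcup_{\alpha<\omega_1}B_\alpha(X)$. $B_1^{st}(X)$ is the set of all $f:X\to\mathbb R$ for which there is a sequence $\{f_n\}$ in $C(X)$ stably converging to $f$, i.e. for every $x\in X$ the set $\{n: f_n(x)\ne f(x)\}$ is finite. All these sets carry the topology of pointwise convergence inherited from $\mathbb R^X$. $X_{\aleph_0}$ is the set $X$ with the Baire topology, whose base is the family of all zero-sets $f^{-1}(0)$, $f:X\to\mathbb R$ continuous. A family $\gamma$ of subsets of a space $Z$ is an $\omega$-cover if every finite subset of $Z$ is contained in some member of $\gamma$. $Z$ has the property $\gamma$ if for every open $\omega$-cover there is a sequence $\{U_n\}_{n\in\omega}$ of its members with $\bigcup_{n}\bigcap_{i\ge n}U_i=Z$. A space is Fréchet–Urysohn if whenever $a\in\overline A$ there is a sequence in $A$ converging to $a$; sequential if for each non-closed $A$ there is a sequence in $A$ converging to a point of $\overline A\setminus A$; a $k$-space if for each non-closed $A$ there is a compact $K$ such that $A\cap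 K$ is not closed in $K$; of countable tightness if whenever $a\in\overline A$ there is a countable $B\subseteq A$ with $a\in\overline B$. *)

(* Defs.v *)
From HB Require Import structures.
From mathcomp Require Import all_boot all_order all_algebra.
From mathcomp Require Import all_classical all_reals all_analysis.
From mathcomp Require wochoice.
Import Order.TTheory GRing.Theory Num.Theory numFieldNormedType.Exports.

Set Implicit Arguments.
Unset Strict Implicit.
Unset Printing Implicit Defensive.

Local Open Scope classical_set_scope.
Local Open Scope ring_scope.

(* The ordinal omega_1.  In any well-ordered uncountable type, here [set nat],
   the points having only countably many predecessors form an initial segment
   of order type omega_1; the lemmas below check this: [omega1] is uncountable
   and well-ordered, and its proper initial segments are countable. *)
Definition set_nat_le : rel (set nat) :=
  sval (wochoice.well_ordering_principle (set nat)).

Definition omega1 : Type :=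
  set_type [set x : set nat | countable [set y | set_nat_le y x]].

Definition omega1_lt (a b : omega1) : Prop :=
  set_nat_le (set_val a) (set_val b) /\ a <> b.

Lemma set_nat_le_min (A : set (set nat)) : A !=set0 ->
  exists2 x, A x & forall y, A y -> set_nat_le x y.
Proof.
case=> a Aa.
have [|z [[Az zmin] _]] :=
  svalP (wochoice.well_ordering_principle (set nat)) (fun x => x \in A).
  by exists a; rewrite unfold_in; exact/mem_set.
exists z; first exact: set_mem.
by move=> y Ay; apply: zmin; rewrite unfold_in; exact/mem_set.
Qed.

Lemma set_nat_le_total x y : set_nat_le x y \/ set_nat_le y x.
Proof.
have [|z [->|->] h] := @set_nat_le_min [set x; y]; first by exists x; left.
- by left; apply: h; right.
- by right; apply: h; left.
Qed.

Lemma set_nat_le_anti x y : set_nat_le x y -> set_nat_le y x -> x = y.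
Proof.
move=> xy yx.
have refl z : set_nat_le z z by case: (set_nat_le_total z z).
have [|m [_ um]] := svalP (wochoice.well_ordering_principle (set nat))
  (fun z => z \in [set x; y]).
  by exists x; rewrite unfold_in; apply/mem_set; left.
rewrite -(um x); first rewrite -(um y) //.
- split; first by rewrite unfold_in; apply/mem_set; right.
  by move=> z; rewrite unfold_in => /set_mem[]->.
- split; first by rewrite unfold_in; apply/mem_set; left.
  by move=> z; rewrite unfold_in => /set_mem[]->.
Qed.

Lemma set_nat_le_trans y x z :
  set_nat_le x y -> set_nat_le y z -> set_nat_le x z.
Proof.
move=> xy yz.
have [|m] := @set_nat_le_min [set x; y; z]; first by exists x; left; left.
move=> [[]|] -> h.
- by apply: h; right.
- have yx : set_nat_le y x by apply: h; left; left.
  by rewrite (set_nat_le_anti xy yx).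
- have zy : set_nat_le z y by apply: h; left; right.
  by rewrite -(set_nat_le_anti yz zy).
Qed.

Lemma set_nat_uncountable : ~ countable [set: set nat].
Proof.
move=> /countable_injP[f finj].
pose D := [set n | exists2 A, f A = n & ~ A n].
have [Df|nDf] := pselect (D (f D)).
- case: (Df) => A fAD; have -> : A = D by apply: finj; rewrite ?inE.
  by apply.
- by apply: (nDf); exists D.
Qed.

Lemma omega1_lt_trans b a c : omega1_lt a b -> omega1_lt b c -> omega1_lt a c.
Proof.
move=> [ab nab] [bc nbc]; split; first exact: set_nat_le_trans bc.
move=> ac; apply: nab; apply/val_inj/set_nat_le_anti => //.
by rewrite ac.
Qed.

Lemma omega1_lt_total a b : [\/ omega1_lt a b, a = b | omega1_lt b a].
Proof.
have [->|/eqP nab] := eqVneq a b; first exact: Or32.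
case: (set_nat_le_total (set_val a) (set_val b)) => h.
- by apply: Or31.
- by apply: Or33; split=> // /esym.
Qed.

Lemma omega1_lt_wf : well_founded omega1_lt.
Proof.
move=> a; apply: contrapT => na.
have [|_ [m nm <-] mmin] :=
  @set_nat_le_min (set_val @` [set x | ~ Acc omega1_lt x]).
  by exists (set_val a), a.
apply: nm; constructor=> b [bm nbm]; apply: contrapT => nb.
apply: nbm; apply/val_inj/set_nat_le_anti => //.
by apply: mmin; exists b.
Qed.

Lemma omega1_lt_countable a : countable [set b | omega1_lt b a].
Proof.
have /set_mem/countable_injP[f finj] := valP a.
apply/countable_injP; exists (f \o set_val) => x y.
rewrite !inE => -[xa _] [ya _] /= fxy.
by apply: val_inj; apply: finj; rewrite ?inE.
Qed.

Lemma omega1_uncountable : ~ countable [set: omega1].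
Proof.
move=> cO; pose S := [set x | countable [set y | set_nat_le y x]].
have cS : countable S.
  move/countable_injP: cO => [f finj].
  pose g x := if pselect (S x) is left Sx then f (exist _ x (mem_set Sx)) else 0%N.
  apply/countable_injP; exists g => x y /set_mem Sx /set_mem Sy; rewrite /g.
  case: pselect => // Sx'; case: pselect => // Sy' /finj.
  by rewrite !inE => /(_ I I) [].
have [|m nSm mmin] := @set_nat_le_min (~` S).
  apply: contrapT => /set0P/negP/negPn/eqP S0; apply: set_nat_uncountable.
  by rewrite -setC0 -S0 setCK.
apply: nSm; apply: (@sub_countable _ _ _ (S `|` [set m])); last first.
  by rewrite -bigcup2E; apply: bigcup_countable => // -[|[|i]] _ /=.
apply: subset_card_le => y /= ym; have [Sy|nSy] := pselect (S y); first by left.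
by right; apply: set_nat_le_anti => //; exact: mmin.
Qed.

Section BaireFunctions.
Context (R : realType) (X : topologicalType).

(* [baire_class a] is B_a(X).  The second constructor needs no hypothesis
   [a <> 0]: there is no [b 0 < a] when [a] is the least element. *)
Inductive baire_class : omega1 -> (X -> R) -> Prop :=
| baire_class_continuous (a : omega1) (f : X -> R) :
    (forall b, ~ omega1_lt b a) -> continuous f -> baire_class a f
| baire_class_limit (a : omega1) (f : X -> R)
    (b : nat -> omega1) (g : nat -> X -> R) :
    (forall n, omega1_lt (b n) a) -> (forall n, baire_class (b n) (g n)) ->
    (forall x, g n x @[n --> \oo] --> f x) -> baire_class a f.

Definition baire_functions : set {ptws X -> R} :=
  \bigcup_(a in [set: omega1]) baire_class a.

Definition stable_baire_one : set {ptws X -> R} :=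
  [set f | exists g : nat -> X -> R,
    (forall n, continuous (g n)) /\
    (forall x, finite_set [set n | g n x <> f x])].

End BaireFunctions.

Arguments baire_functions : clear implicits.
Arguments stable_baire_one : clear implicits.

Definition tychonoff_space (X : topologicalType) :=
  completely_regular_space X /\ hausdorff_space X.

(* X_{aleph_0}: the carrier of X, topologized by the base of zero-sets of
   continuous functions X -> R. *)
Definition aleph0_space (R : realType) (X : topologicalType) : Type := X.

Section Aleph0Space.
Context (R : realType) (X : topologicalType).

Definition zero_sets : set (set X) :=
  [set Z | exists2 f : X -> R, continuous f & Z = f @^-1` [set 0]].

Lemma zero_sets_cover : \bigcup_(Z in zero_sets) Z = setT.
Proof.
apply/seteqP; split => // x _; exists setT => //.
exists (fun=> 0); first by move=> y; exact: cvg_cst.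
by apply/seteqP; split.
Qed.

Lemma zero_sets_join (Z W : set X) (x : X) : zero_sets Z -> zero_sets W ->
  Z x -> W x -> exists V, [/\ zero_sets V, V x & V `<=` Z `&` W].
Proof.
move=> [f cf ->] [g cg ->] fx gx.
exists ((fun y => `|f y| + `|g y|) @^-1` [set 0]); split.
- exists (fun y => `|f y| + `|g y|) => // y.
  by apply: cvgD; apply: cvg_norm; [exact: cf|exact: cg].
- by rewrite /= fx gx normr0 addr0.
- move=> y /eqP; rewrite /= paddr_eq0 // !normr_eq0.
  by move=> /andP[/eqP -> /eqP ->].
Qed.

HB.instance Definition _ := Choice.on (aleph0_space R X).
HB.instance Definition _ := isBaseTopological.Build (aleph0_space R X)
  zero_sets_cover zero_sets_join.

Lemma open_aleph0E (U : set (aleph0_space R X)) :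
  open U <-> exists2 D, D `<=` zero_sets & \bigcup_(Z in D) Z = U.
Proof. by []. Qed.

End Aleph0Space.

Section TopologicalProperties.
Context (Z : topologicalType).

Definition omega_cover (U : set (set Z)) :=
  forall F : set Z, finite_set F -> exists2 V, U V & F `<=` V.

Definition property_gamma :=
  forall U : set (set Z), U `<=` open -> omega_cover U ->
  exists u : nat -> set Z, (forall n, U (u n)) /\
    \bigcup_n \bigcap_(i in [set i | (n <= i)%N]) u i = setT.

Definition frechet_urysohn :=
  forall (A : set Z) (a : Z), closure A a ->
  exists u : nat -> Z, (forall n, A (u n)) /\ u @ \oo --> a.

Definition sequential :=
  forall A : set Z, ~ closed A ->
  exists (u : nat -> Z) (a : Z),
    [/\ forall n, A (u n), (closure A `\` A) a & u @ \oo --> a].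

Definition k_space :=
  forall A : set Z, ~ closed A ->
  exists K : set Z, compact K /\ ~ closed (A `&` K : set (subspace K)).

Definition countably_tight :=
  forall (A : set Z) (a : Z), closure A a ->
  exists B : set Z, [/\ B `<=` A, countable B & closure B a].

End TopologicalProperties.

(* Main.v *)
Require Import Defs.
From mathcomp Require Import all_boot all_order all_algebra.
From mathcomp Require Import all_classical all_reals all_analysis.
From mathcomp Require Import finmap lra.
Import Order.TTheory GRing.Theory Num.Theory numFieldNormedType.Exports.

Set Implicit Arguments.
Unset Strict Implicit.
Unset Printing Implicit Defensive.

Local Open Scope classical_set_scope.
Local Open Scope ring_scope.

(** The bridge between the two sides is that [aleph0_space R X], written Z
    below, is a P-space: countable intersections of zero-sets are zero-sets, so
    countable intersections of open sets of Z are open.  By induction on the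
    Baire class, every Baire function is constant near each point of Z
    ([baire_locally_constant]); in the other direction, a function taking one
    value on a zero-set and another one off it is a stable limit of continuous
    functions ([two_valued_stable]).  Hence H consists of locally constant
    functions on Z and contains all two-valued functions given by zero-sets;
    the proof works from these two facts.

    The equivalences are proved in a cycle.  Both countable tightness of H and
    the property gamma of Z say something about countable omega-subcovers, and
    the intermediate notion is [omega_lindelof]: every open omega-cover of Z
    contains a countable omega-cover.

    - Countable tightness gives [omega_lindelof]: the constant 1 is in the
      closure of the indicators of the zero-sets contained in members of the
      omega-cover, and a countable set of indicators with 1 in its closure gives
      a countable omega-cover.
    - In an omega-Lindelof P-space, from a sequence of open omega-covers one can
      select members that eventually contain each point
      ([omega_cover_selection]): countably many sets of the covers matter, so
      all the requirements at a point x already hold on a neighbourhood of x,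
      and countably many such neighbourhoods cover Z.  For a constant sequence
      of covers this is the property gamma; for the covers by the sets where
      |f - a| < 1/(n+1), f ranging over A, it is the Frechet-Urysohn property of
      H at a point a of the closure of A.
    - That k-spaces H are countably tight is the main step.  Kelley's
      argument that an uncountable power of the real line is not a k-space uses
      the functions equal to 0 on a set of at most n indices and to n off it.
      Its generalization [k_space_countable_colors] bounds, instead of the number of
      points of W, the number of colors of the finite subsets of W: if H is a
      k-space, then a coloring of the finite subsets of X which is locally
      finite has only countably many colors.  If H is a k-space but not
      countably tight, there are a set A closed under closures of countable
      sets and a compact K such that the trace of A on K is not closed in K.
      A recursion of length omega_1 then builds a free sequence f_a in K
      ([free_sequence]) with a limit y'.  Since Z is a P-space, coloring a
      finite set E by the first a for which f_a is close to y' on E is locally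
      finite; so the colors are bounded by some d < omega_1, against the
      freeness of the sequence at the index d. *)

(** * Finite and countable sets *)

Lemma countable_image (T U : Type) (f : T -> U) (A : set T) :
  countable A -> countable (f @` A).
Proof. exact/sub_countable/card_image_le. Qed.

Lemma finite_subsets (T : choiceType) (E : set T) :
  finite_set E -> finite_set [set G | G `<=` E].
Proof.
move=> /finite_fsetP[S ->].
apply: (@sub_finite_set _ _
  ((fun P : {fset T} => [set` P]) @` [set` fpowerset S])); last first.
  by apply: finite_image; exact: finite_fset.
move=> G GS; have fG : finite_set G by apply: sub_finite_set GS (finite_fset S).
exists (fset_set G); last exact: fset_setK.
rewrite /= fpowersetE; apply/fsubsetP => x.
by rewrite in_fset_set // => /set_mem/GS.
Qed.

Lemma filter_finite_bigcap (I : choiceType) (T : Type) (G : set_system T)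
    (E : set I) (P : I -> set T) :
  Filter G -> finite_set E -> (forall i, E i -> G (P i)) ->
  G [set t | forall i, E i -> P i t].
Proof.
move=> FG /finite_fsetP[S ->] GP.
have := @filter_bigI _ _ S P G FG (fun i iS => GP i iS).
by apply: filterS => t St i /St.
Qed.

(** * The topology of pointwise convergence *)

Section PointwiseTopology.
Context (R : realType) (X : topologicalType) (H : set {ptws X -> R}).

Definition close_on (F : set X) (k : nat) (f g : X -> R) : Prop :=
  forall x, F x -> `|f x - g x| < k.+1%:R^-1.

Lemma eval_continuous (x : X) : continuous (fun h : H => set_val h x).
Proof.
move=> h.
apply: (@continuous_comp _ _ _ (set_val : H -> {ptws X -> R}) (fun f => f x)).
  exact: initial_continuous.
exact: (@proj_continuous X (fun=> R : topologicalType) x).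
Qed.

Lemma near_close_on (a : H) (F : set X) (k : nat) : finite_set F ->
  \forall h \near a, close_on F k (set_val h) (set_val a).
Proof.
move=> finF.
have := @filter_finite_bigcap _ _ (nbhs a) F
  (fun x => [set h : H | `|set_val h x - set_val a x| < k.+1%:R^-1]).
apply=> // x _.
have k0 : 0 < k.+1%:R^-1 :> R by rewrite invr_gt0.
have /cvgrPdist_lt /(_ _ k0) := @eval_continuous x a.
by apply: filterS => h /=; rewrite distrC.
Qed.

(** The sets described by [close_on] form a filter that converges to [a] at
    every point, hence converges to [a] in the product topology: this spares
    unfolding the subbase of the supremum topology. *)
Lemma nbhs_close_onP (a : H) (S : set H) : nbhs a S ->
  exists F k, finite_set F /\
    forall h : H, close_on F k (set_val h) (set_val a) -> S h.
Proof.
have inv_le (k m : nat) : (k <= m)%N -> m.+1%:R^-1 <= k.+1%:R^-1 :> R.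
  by move=> km; rewrite lef_pV2 ?posrE // ler_nat.
pose G : set_system {ptws X -> R} := [set S | exists F k, finite_set F /\
  forall h : X -> R, close_on F k h (set_val a) -> S h].
have FG : Filter G.
  split.
  - by exists set0, 0%N.
  - move=> A B [F1 [k1 [f1 h1]]] [F2 [k2 [f2 h2]]].
    exists (F1 `|` F2), (maxn k1 k2); split; first by rewrite finite_setU.
    move=> h ch; split; [apply: h1|apply: h2] => x Fx.
    + by apply: lt_le_trans (ch x _) (inv_le _ _ (leq_maxl _ _)); left.
    + by apply: lt_le_trans (ch x _) (inv_le _ _ (leq_maxr _ _)); right.
  - move=> A B AB [F [k [fF hF]]]; exists F, k; split=> // h /hF; exact: AB.
have Ga : G --> (set_val a : {ptws X -> R}).
  apply/cvg_sup => x; apply/cvg_image.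
    apply/seteqP; split=> // r _; exists (fun=> r) => //.
  move=> /= B /nbhs_ballP[e /= e0 eB].
  exists [set f : {ptws X -> R} | B (f x)]; last first.
    by apply/seteqP; split=> [r [f Bf <-]//|r Br]; exists (fun=> r).
  have [k _ /(_ k (leqnn k)) /= ke] := near_infty_natSinv_lt (PosNum e0).
  exists [set x], k; split=> // h ch; apply: eB; rewrite /ball /= distrC.
  by apply: lt_trans ke; exact: ch.
move=> -[_ [[B oB <-] Ba] BS].
have /Ga : nbhs (set_val a : {ptws X -> R}) B by apply: open_nbhs_nbhs.
by move=> [F [k [fF hF]]]; exists F, k; split=> // h /hF ?; apply: BS.
Qed.

Lemma closure_close_onP (A : set H) (a : H) :
  closure A a <-> forall F k, finite_set F ->
    exists2 f, A f & close_on F k (set_val f) (set_val a).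
Proof.
split=> [cA F k fF|cA S /nbhs_close_onP[F [k [fF FS]]]].
  by have [f [Af cf]] := cA _ (near_close_on a k fF); exists f.
by have [f Af cf] := cA F k fF; exists f; split=> //; exact: FS.
Qed.

Lemma cvg_pointwiseP (u : nat -> H) (a : H) :
  (forall x k, \forall n \near \oo, close_on [set x] k (set_val (u n)) (set_val a))
  -> u @ \oo --> a.
Proof.
move=> ua S /nbhs_close_onP[F [k [fF FS]]].
have := @filter_finite_bigcap _ _ \oo F
  (fun x => [set n | close_on [set x] k (set_val (u n)) (set_val a)]).
move=> /(_ _ fF (fun x _ => ua x k)).
by apply: filterS => n ch; apply: FS => x Fx; exact: (ch x Fx x).
Qed.

End PointwiseTopology.

(** * Sequential spaces and k-spaces *)

Section SequencesAndCompacta.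
Context (Y : topologicalType).

Lemma frechet_urysohn_sequential : frechet_urysohn Y -> sequential Y.
Proof.
move=> fu A /existsNP[a /not_implyP[cAa nAa]].
by have [u [Au ua]] := fu A a cAa; exists u, a.
Qed.

Lemma compact_cvg_range (u : nat -> Y) (a : Y) :
  u @ \oo --> a -> compact (a |` range u).
Proof.
move=> ua F PF FK; apply: contrapT => nK.
have : ~ cluster F a by move=> ca; apply: nK; exists a; split=> //; left.
move=> /existsNP[S /existsNP[U /not_implyP[FS /not_implyP[aU SU]]]].
have [N _ uU] := ua _ aU.
have : F (u @` `I_N).
  apply: filterS (filterI FS FK) => y [Sy [ya|[n _ uny]]].
    by exfalso; apply: SU; exists y; split=> //; rewrite ya; exact: nbhs_singleton.
  have [nN|Nn] := ltnP n N; first by exists n.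
  exfalso; apply: SU; exists y; split=> //; rewrite -uny; exact: uU.
move=> /(finite_compact (finite_image u (finite_II N)))[y [[n _ uny] cy]].
by apply: nK; exists y; split=> //; right; exists n.
Qed.

Lemma sequential_k_space : sequential Y -> k_space Y.
Proof.
move=> sq A /sq[u [a [Au [_ nAa] ua]]].
exists (a |` range u); split; first exact: compact_cvg_range.
move=> /closed_subspaceP[V cV VA].
have Vu n : V (u n).
  have : (A `&` (a |` range u) `&` (a |` range u)) (u n).
    by do !split => //; right; exists n.
  by rewrite -VA => -[].
have Va : V a by apply: (@closed_cvg _ _ \oo _ u V) ua => //; exact: nearW.
apply: nAa.
have : (V `&` (a |` range u)) a by split=> //; left.
by rewrite VA => -[[]].
Qed.

Lemma k_space_limit (A : set Y) : k_space Y -> ~ closed A ->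
  exists K y, [/\ compact K, K y, closure (A `&` K) y & ~ A y].
Proof.
move=> kY /kY[K [cK nAK]]; apply: contrapT => nKy; apply: nAK.
apply/closed_subspaceP; exists (closure (A `&` K)); first exact: closed_closure.
apply/seteqP; split=> y [cy Ky]; last by split=> //; exact: subset_closure.
split=> //; split=> //; apply: contrapT => nAy.
by apply: nKy; exists K, y.
Qed.

End SequencesAndCompacta.

(** * Omega-covers of P-spaces *)

Section OmegaCovers.
Context (Y : topologicalType).

Definition p_space : Prop := forall (I : Type) (D : set I) (U : I -> set Y),
  countable D -> (forall i, D i -> open (U i)) -> open (\bigcap_(i in D) U i).

Definition omega_lindelof : Prop := forall U : set (set Y), U `<=` open ->
  omega_cover U ->
  exists u : nat -> set Y, (forall n, U (u n)) /\ omega_cover (range u).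

Lemma property_gamma_omega_lindelof : property_gamma Y -> omega_lindelof.
Proof.
move=> gY U oU cU; have [u [Uu uT]] := gY U oU cU; exists u; split=> // F fF.
have /choice[N NP] : forall y : Y, exists N, forall n, (N <= n)%N -> u n y.
  move=> y; have : [set: Y] y by [].
  by rewrite -uT => -[N _ uN]; exists N.
have := @filter_finite_bigcap Y _ \oo F (fun y => u^~ y).
move=> /(_ _ fF (fun y _ => ex_intro2 _ _ (N y) Logic.I (NP y)))[M _ MP].
by exists (u M); [exists M|move=> y Fy; apply: (MP M) => /=].
Qed.

(** First [omega_lindelof] replaces each cover by a countable one.  Then the
    intersection [G x] of all the sets of these covers that contain [x] is open,
    since [Y] is a P-space, and finitely many points per stage suffice: if
    [y] lies in [G x], then a set chosen to contain [x] also contains [y].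
    Countably many [G x] cover [Y] by [omega_lindelof] applied to their finite
    unions [GF F]. *)
Lemma omega_cover_selection (I : Type) (U : nat -> I -> set Y) :
  p_space -> omega_lindelof -> (forall n i, open (U n i)) ->
  (forall n, omega_cover (range (U n))) ->
  exists s : nat -> I, forall y, \forall n \near \oo, U n (s n) y.
Proof.
move=> pY LY oU cU.
have /choice[i iP] : forall n, exists i : nat -> I,
    omega_cover (range (fun k => U n (i k))).
  move=> n; have [|u [Uu cu]] := LY _ _ (cU n); first by move=> _ [j _ <-].
  have /choice[i ui] : forall k, exists j, U n j = u k.
    by move=> k; have [j _ <-] := Uu k; exists j.
  by exists i; rewrite (_ : (fun k => _) = u)//; apply/funext.
pose G x := \bigcap_(p in [set p : nat * nat | U p.1 (i p.1 p.2) x])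
  U p.1 (i p.1 p.2).
have oG x : open (G x) by apply: pY => // p _; exact: oU.
pose GF F := \bigcup_(x in F) G x.
have [|F0 fF0|g [gG cg]] := LY (GF @` finite_set).
- by move=> _ [F _ <-]; exact: bigcup_open.
- exists (GF F0); first by exists F0.
  by move=> x Fx; exists x => // p.
have /choice[F FP] : forall m, exists F, finite_set F /\ GF F = g m.
  by move=> m; have [F fF <-] := gG m; exists F.
pose E n := \bigcup_(m in `I_n.+1) F m.
have fE n : finite_set (E n).
  by apply: bigcup_finite => [|m _]; [exact: finite_II|exact: (FP m).1].
have /choice[k kP] : forall n, exists k, E n `<=` U n (i n k).
  by move=> n; have [_ [k _ <-] Ek] := iP n (E n) (fE n); exists k.
exists (fun n => i n (k n)) => y.
have [_ [m _ <-] /(_ y erefl)] := cg [set y] (finite_set1 y).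
rewrite -(FP m).2 => -[x Fx Gxy].
exists m => // n /= mn; apply: (Gxy (n, k n)) => /=; apply: kP.
by exists m.
Qed.

Lemma omega_lindelof_property_gamma :
  p_space -> omega_lindelof -> property_gamma Y.
Proof.
move=> pY LY U oU cU.
have [|_ |s sP] := @omega_cover_selection {V | U V} (fun _ => sval) pY LY.
- by move=> _ V; exact/oU/svalP.
- by move=> F /cU[V UV FV]; exists V => //; exists (exist _ V UV).
exists (fun n => sval (s n)); split=> [n|]; first exact: svalP.
apply/seteqP; split=> // y _; have [N _ NP] := sP y.
by exists N.
Qed.

End OmegaCovers.

(** * Zero-sets and the Baire topology *)

Section ZeroSets.
Context (R : realType) (X : topologicalType).
Local Notation zero_set := (@zero_sets R X).

Lemma zero_setT : zero_set setT.
Proof.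
exists (fun=> 0); first by move=> y; exact: cvg_cst.
by apply/seteqP; split.
Qed.

Lemma zero_setU (V W : set X) : zero_set V -> zero_set W -> zero_set (V `|` W).
Proof.
move=> [f cf ->] [g cg ->]; exists (fun x => f x * g x).
  by move=> x; apply: cvgM; [exact: cf|exact: cg].
apply/seteqP; split=> x /=; first by case=> ->; rewrite ?mul0r ?mulr0.
by move/eqP; rewrite mulf_eq0 => /orP[] /eqP; [left|right].
Qed.

Lemma zero_set_bigcup (I : choiceType) (F : set I) (W : I -> set X) :
  finite_set F -> (forall i, F i -> zero_set (W i)) ->
  zero_set (\bigcup_(i in F) W i).
Proof.
move=> /finite_fsetP[S ->] zW; rewrite -bigsetU_fset_set; last exact: finite_fset.
rewrite big_seq; elim/big_ind: _ => [||i]; [|exact: zero_setU|].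
  exists (fun=> 1); first by move=> y; exact: cvg_cst.
  by apply/seteqP; split=> // x /= /eqP; rewrite oner_eq0.
by rewrite in_fset_set; [move=> /set_mem; exact: zW|exact: finite_fset].
Qed.

(** The supremum of the truncations min(|f n|, 1/(n+1)) vanishes exactly on the
    intersection; it is continuous because, up to a given error, only finitely
    many of its terms matter. *)
Lemma zero_set_bigcap_nat (W : nat -> set X) :
  (forall n, zero_set (W n)) -> zero_set (\bigcap_n W n).
Proof.
move=> zW.
have /choice[f fP] : forall n, exists f : X -> R,
    continuous f /\ W n = f @^-1` [set 0].
  by move=> n; have [f cf ->] := zW n; exists f.
pose t n x : R := Num.min `|f n x| n.+1%:R^-1.
have t0 n x : 0 <= t n x by rewrite /t le_min normr_ge0 invr_ge0 ler0n.
have tle n x : t n x <= n.+1%:R^-1 by rewrite /t ge_min lexx orbT.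
pose T x : set R := range (t^~ x).
have inv_le1 n : n.+1%:R^-1 <= 1 :> R by rewrite invf_le1 // ler1n.
have Tsup x : has_sup (T x).
  split; first by exists (t 0%N x), 0%N.
  by exists 1 => _ [n _ <-]; exact: le_trans (tle n x) (inv_le1 n).
pose g x := sup (T x).
have tg n x : t n x <= g x by apply: ub_le_sup; [exact: (Tsup x).2|exists n].
have sup_le (x : X) (c : R) : (forall n, t n x <= c) -> g x <= c.
  move=> tc; apply: ge_sup; first exact: (Tsup x).1.
  by move=> _ [n _ <-].
exists g; last first.
  apply/seteqP; split=> x.
    move=> Wx; apply/eqP; rewrite eq_le (le_trans (t0 0%N x)) // andbT.
    apply: sup_le => n; rewrite /t; have := Wx n I.
    by rewrite (fP n).2 /= => ->; rewrite normr0 ge_min lexx.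
  move=> /= gx n _; rewrite (fP n).2 /=.
  have : t n x <= 0 by rewrite -gx.
  rewrite /t ge_min => /orP[|]; first by rewrite normr_le0 => /eqP.
  by rewrite invr_le0 lern0.
move=> x; apply/cvgrPdist_le => e e0.
have [N _ /= Ne] := near_infty_natSinv_lt (PosNum e0).
have := @filter_finite_bigcap _ _ (nbhs x) `I_N
  (fun n => [set y | `|f n x - f n y| <= e]).
move=> /(_ _ (finite_II N)) /=.
have fe i : (i < N)%N -> nbhs x [set y | `|f i x - f i y| <= e].
  by move=> _; have /cvgrPdist_le /(_ _ e0) := (fP i).1 x.
move=> /(_ fe); apply: filterS => y /= fy.
(* For n >= N the term is at most 1/(n+1) < e, whatever the point. *)
have bd n u v : (forall i, (i < N)%N -> `|f i u - f i v| <= e) ->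
    t n u <= g v + e.
  move=> fuv; have [nN|Nn] := ltnP n N.
    have : t n u <= t n v + e.
      rewrite /t -lerBlDr le_min; apply/andP; split; rewrite lerBlDr ge_min.
        have := fuv n nN; have := ler_normD (f n u - f n v) (f n v).
        by rewrite subrK => h1 h2; apply/orP; left; lra.
      by apply/orP; right; rewrite lerDl ltW.
    move=> /le_trans; apply; by rewrite lerD2r.
  apply: le_trans (tle n u) _; apply: le_trans (ltW (Ne n Nn)) _.
  by rewrite lerDr; exact: le_trans (t0 0%N v) (tg 0%N v).
have h1 : g x <= g y + e by apply: sup_le => n; apply: bd.
have h2 : g y <= g x + e.
  by apply: sup_le => n; apply: bd => i /fy; rewrite distrC.
by rewrite ler_norml; apply/andP; split; lra.
Qed.

Lemma zero_set_bigcap (I : Type) (D : set I) (W : I -> set X) :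
  countable D -> (forall i, D i -> zero_set (W i)) ->
  zero_set (\bigcap_(i in D) W i).
Proof.
move=> /countable_injP[f finj] zW.
pose V n := [set x | forall i, D i -> f i = n -> W i x].
have -> : \bigcap_(i in D) W i = \bigcap_n V n.
  apply/seteqP; split=> [x Wx n _ i Di _|x Vx i Di]; first exact: Wx.
  exact: (Vx (f i) Logic.I i Di erefl).
apply: zero_set_bigcap_nat => n.
have [[i Di fi]|nD] := pselect (exists2 i, D i & f i = n).
  have -> : V n = W i; last exact: zW.
  apply/seteqP; split=> [x /(_ i Di fi)//|x Wx j Dj fj].
  by rewrite (finj j i (mem_set Dj) (mem_set Di)) // fj fi.
have -> : V n = setT; last exact: zero_setT.
by apply/seteqP; split=> // x _ i Di fi; exfalso; apply: nD; exists i.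
Qed.

Lemma zero_set_open (W : set X) :
  zero_set W -> open (W : set (aleph0_space R X)).
Proof.
move=> zW; apply/open_aleph0E; exists [set W]; first by move=> _ ->.
by rewrite bigcup_set1.
Qed.

Lemma open_zero_set (U : set (aleph0_space R X)) (x : X) : open U -> U x ->
  exists W : set X, [/\ zero_set W, W x & W `<=` U].
Proof.
move=> /open_aleph0E[D DZ <-] [W DW Wx]; exists W; split=> //; first exact: DZ.
by move=> y Wy; exists W.
Qed.

Lemma aleph0_p_space : p_space (aleph0_space R X).
Proof.
move=> I D U cD oU; apply/open_aleph0E.
exists [set W | zero_set W /\ W `<=` \bigcap_(i in D) U i]; first by move=> W [].
apply/seteqP; split=> [x [W [_ WU] /WU//]|x Ux].
have /choice[W WP] : forall i, exists W : set X,
    D i -> [/\ zero_set W, W x & W `<=` U i].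
  move=> i; have [Di|nDi] := pselect (D i); last by exists setT.
  have [W WP] := open_zero_set (oU i Di) (Ux i Di); by exists W.
exists (\bigcap_(i in D) W i); last by move=> i /WP[].
split; first by apply: zero_set_bigcap => // i /WP[].
by move=> y Wy i Di; have [_ _] := WP i Di; apply; exact: Wy.
Qed.

(** The approximations are b + (a - b) max(0, 1 - n |h|): they equal [a] where
    h vanishes, and [b] as soon as n |h| >= 1. *)
Lemma two_valued_stable (W : set X) (a b : R) : zero_set W ->
  stable_baire_one R X (fun x => if x \in W then a else b).
Proof.
move=> [h ch ->].
pose g (n : nat) x : R := b + (a - b) * Num.max 0 (1 - n%:R * `|h x|).
exists g; split.
  move=> n x; apply: cvgD; first exact: cvg_cst.
  apply: cvgM; first exact: cvg_cst.
  apply: (@continuous_max R X (fun=> 0) (fun x => 1 - n%:R * `|h x|)).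
    exact: cvg_cst.
  apply: cvgB; first exact: cvg_cst.
  by apply: cvgM; [exact: cvg_cst|apply: cvg_norm; exact: ch].
move=> x; have [hx|hx] := eqVneq (h x) 0.
  apply: sub_finite_set (finite_set0 nat) => n /=; case.
  rewrite /g hx normr0 mulr0 subr0 max_r // mulr1 addrC subrK.
  by rewrite ifT //; exact: mem_set.
have [N] : exists N : nat, 1 <= N%:R * `|h x|.
  exists (Num.truncn `|h x|^-1).+1.
  rewrite -ler_pdivrMr ?normr_gt0 // mul1r.
  exact/ltW/truncnS_gt.
move=> hN.
apply: sub_finite_set (finite_II N) => n /= gn; rewrite ltnNge.
apply/negP => Nn; apply: gn; rewrite /g max_l; last first.
  rewrite subr_le0; apply: le_trans hN _; apply: ler_wpM2r => //.
  by rewrite ler_nat.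
rewrite mulr0 addr0 ifF //; apply/negbTE; rewrite notin_setE /=.
by move=> /eqP; apply/negP.
Qed.

(** Local constancy for the Baire topology.  It survives pointwise limits of
    sequences because countable intersections of zero-sets are zero-sets. *)
Definition zero_locally_constant (f : X -> R) : Prop := forall x,
  exists W : set X, [/\ zero_set W, W x & forall y, W y -> f y = f x].

Lemma baire_locally_constant (f : X -> R) :
  baire_functions R X f -> zero_locally_constant f.
Proof.
move=> + x => -[a _]; elim=> {a f} [a f _ cf|a f b g _ _ IH gf].
  exists [set y | f y = f x]; split=> //.
  exists (fun y => f y - f x).
    by move=> y; apply: cvgB; [exact: cf|exact: cvg_cst].
  by apply/seteqP; split=> y /= => [->|/eqP]; rewrite ?subrr // subr_eq0 => /eqP.
have /choice[W WP] := IH; exists (\bigcap_n W n); split.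
- by apply: zero_set_bigcap_nat => n; have [] := WP n.
- by move=> n _; have [] := WP n.
- move=> y Wy.
  have gy : (g n y @[n --> \oo] --> f x).
    suff -> : (fun n => g n y) = (fun n => g n x) by exact: gf.
    by apply/funext => n; have [_ _] := WP n; apply; exact: Wy.
  exact: cvg_unique (gf y) gy.
Qed.

End ZeroSets.

(** * Kelley's argument in k-spaces of functions *)

Section Kelley.
Context (R : realType) (X : topologicalType) (H : set {ptws X -> R}).
Local Notation zero_set := (@zero_sets R X).
Context (sH : stable_baire_one R X `<=` H).

Lemma two_valued_ex (W : set X) (a b : R) : zero_set W ->
  exists h : H, forall x, set_val h x = if x \in W then a else b.
Proof.
move=> zW; have Hh := mem_set (sH (two_valued_stable a b zW)).
by exists (exist (fun f : {ptws X -> R} => f \in H) _ Hh).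
Qed.

Lemma compact_eval_bounded (K : set H) (x : X) : compact K ->
  \forall N \near \oo, forall h, K h -> set_val h x < N%:R.
Proof.
move=> cK; have : compact ((fun h : H => set_val h x) @` K).
  apply: continuous_compact => //.
  by apply: continuous_subspaceT; exact: eval_continuous.
move=> /compact_bounded[M [_ Mb]].
exists (Num.truncn `|M + 1|).+1 => // N /= MN h Kh.
have := Mb (M + 1); rewrite ltrDl ltr01 => /(_ isT (set_val h x)).
move=> /(_ (ex_intro2 _ _ h Kh erefl)) hM.
apply: le_lt_trans (ler_norm _) _; apply: le_lt_trans hM _.
apply: le_lt_trans (ler_norm _) _.
by apply: lt_le_trans (truncnS_gt _) _; rewrite ler_nat.
Qed.

Definition colors (T : Type) (c : set X -> T) (W : set X) : set T :=
  c @` [set G | finite_set G /\ G `<=` W].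

(** Let [A n] consist of the functions equal to 1/(n+1) on a zero-set W with at
    most n colors, and to n+1 off W.  Local finiteness puts 0 in the closure of
    the union [M] of the closures of the [A n], while 0 is not in [M].
    The values n+1 matter because a compact K is bounded at each point: if K
    meets [closure (A n)] for arbitrarily large n, at functions g, then each
    finite set is contained in some set [V N] of the form g < n+1.  Such a set
    inherits from [A n] that it has finitely many colors, so there are countably
    many colors.  Such a K exists: otherwise [M] meets each compact set inside
    a finite union of closed subsets of [M], which makes [M] closed in a
    k-space. *)
Lemma k_space_countable_colors (T : Type) (c : set X -> T) :
  (forall F, finite_set F ->
    exists W, [/\ zero_set W, F `<=` W & finite_set (colors c W)]) ->
  k_space H -> countable (colors c setT).
Proof.
move=> cfin kH.
(* A point is needed to separate 0 from [A n]; without points only the empty set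
   is colored. *)
have [[x0 _]|nX] := pselect (exists x : X, True); last first.
  apply: sub_countable (countable1 (c set0)); apply: subset_card_le.
  move=> _ [G _ <-]; rewrite /set1 /=; congr c.
  by apply/seteqP; split=> x; [move=> _; apply: nX; exists x|].
pose A n : set H := [set h | exists W, [/\ zero_set W, (colors c W #<= `I_n)%card
  & forall x, set_val h x = if x \in W then n.+1%:R^-1 else n.+1%:R]].
pose M := \bigcup_n closure (A n).
have [z zE] := two_valued_ex 0 0 (zero_setT R X).
have val_z x : set_val z x = 0 by rewrite zE; case: ifP.
have inv_le n : n.+1%:R^-1 <= n.+1%:R :> R.
  by apply: (@le_trans _ _ 1); rewrite ?invf_le1 ?ler1n.
have nMz : ~ M z.
  move=> [n _ /closure_close_onP/(_ _ n (finite_set1 x0))[f [W [_ _ fW]]]].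
  move=> /(_ x0 erefl); rewrite val_z subr0 fW ltNge => /negP; apply.
  by rewrite ger0_norm; case: ifP; rewrite ?lexx ?invr_ge0 ?ler0n ?inv_le.
have cMz : closure M z.
  apply/closure_close_onP => F k fF.
  have [W [zW FW /finite_set_leP[m Wm]]] := cfin F fF.
  pose n := maxn m k.+1.
  have [h hE] := two_valued_ex n.+1%:R^-1 n.+1%:R zW.
  exists h.
    exists n => //; apply: subset_closure; exists W; split=> //.
    by apply: card_le_trans Wm _; rewrite card_le_II leq_maxl.
  move=> x Fx; rewrite val_z subr0 hE ifT; last exact/mem_set/FW.
  rewrite ger0_norm ?invr_ge0 // ltf_pV2 ?posrE // ltr_nat ltnS.
  exact: leq_maxr.
have ncM : ~ closed M by move=> clM; apply/nMz/clM.
have [K [y [cK Ky cy nMy]]] := k_space_limit kH ncM.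
have : forall N, exists p : nat * H,
    [/\ (N <= p.1)%N, K p.2 & closure (A p.1) p.2].
  move=> N; apply: contrapT => nN; apply: nMy.
  have : closed (\bigcup_(n in `I_N) closure (A n)).
    by apply: closed_bigcup => [|n _]; [exact: finite_II|exact: closed_closure].
  move=> /(_ y) []; last by move=> n _ Any; exists n.
  apply: closureS cy => g [[n _ Ang] Kg]; exists n => //=.
  by rewrite ltnNge; apply/negP => Nn; apply: nN; exists (n, g).
move=> /choice[s sP].
pose V N := [set x | set_val (s N).2 x < (s N).1.+1%:R].
have VW N E : finite_set E -> E `<=` V N ->
    exists W, (colors c W #<= `I_(s N).1)%card /\ E `<=` W.
  move=> fE EV; have [_ _ cA] := sP N.
  have nE : nbhs (s N).2
      [set h : H | forall x, E x -> set_val h x < (s N).1.+1%:R].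
    apply: (@filter_finite_bigcap _ _ _ E
      (fun x => [set h : H | set_val h x < (s N).1.+1%:R])) => // x Ex.
    apply: (@eval_continuous _ _ H x (s N).2 [set r | r < (s N).1.+1%:R]).
    by apply: open_nbhs_nbhs; split; [exact: open_lt|exact: EV].
  have [h [[W [_ Wn hW]] hE]] := cA _ nE.
  exists W; split=> // x Ex; apply/set_mem; apply: contraT => xW.
  by have := hE x Ex; rewrite hW (negbTE xW) ltxx.
(* n+1 finite subsets of [V N] with distinct colors would be contained in a set
   [W] with at most n colors. *)
have Vfin N : finite_set (colors c (V N)).
  apply: contrapT => /infiniteP/card_leP[f0].
  pose f i := set_val (f0 (to_setT i)).
  have finj : injective f.
    by move=> i j /val_inj/inj; move=> /(_ (in_setT _) (in_setT _))/(congr1 set_val).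
  have /choice[G GP] : forall i, exists G,
      [/\ finite_set G, G `<=` V N & c G = f i].
    by move=> i; have [G [fG GV] cG] := set_valP (f0 (to_setT i)); exists G.
  pose n := (s N).1; pose E := \bigcup_(i in `I_n.+1) G i.
  have fE : finite_set E.
    by apply: bigcup_finite => [|i _]; [exact: finite_II|have [] := GP i].
  have [|W [Wn EW]] := VW N E fE.
    by move=> x [i _ Gx]; have [_ + _] := GP i; apply.
  have : (`I_n.+1 #<= `I_n)%card; last by rewrite card_le_II ltnn.
  apply: card_le_trans Wn.
  have fI : (f @` `I_n.+1 #= `I_n.+1)%card.
    by apply: inj_card_eq => i j _ _; exact: finj.
  rewrite -(card_le_eql fI).
  apply: subset_card_le => _ [i iN <-]; have [fG _ <-] := GP i.
  by exists (G i) => //; split=> // x Gx; apply: EW; exists i.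
apply: (@sub_countable _ _ _ (\bigcup_N colors c (V N))); last first.
  by apply: bigcup_countable => // N _; exact: finite_set_countable.
apply: subset_card_le => _ [G [fG _] <-].
have := @filter_finite_bigcap _ _ \oo G
  (fun x N => forall h : H, K h -> set_val h x < N%:R).
move=> /(_ _ fG (fun x _ => compact_eval_bounded x cK))[N _ /(_ N (leqnn N)) GN].
exists N => //; exists G => //; split=> // x Gx; have [Np Kp _] := sP N.
by apply: lt_le_trans (GN x Gx _ Kp) _; rewrite ler_nat ltnW.
Qed.

End Kelley.

(** * Recursion and boundedness in omega_1 *)

Lemma omega1_recursion (T : Type) (step : set T -> T) :
  exists p : omega1 -> T, forall a, p a = step (p @` [set b | omega1_lt b a]).
Proof.
pose body (a : omega1) (rec : forall b, omega1_lt b a -> T) :=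
  step [set t | exists b (ba : omega1_lt b a), rec b ba = t].
exists (Fix omega1_lt_wf (fun=> T) body) => a; rewrite Fix_eq.
  congr step; apply/seteqP; split=> [t [b [ba <-]]|_ [b ba <-]]; first by exists b.
  by exists b, ba.
move=> x f g fg; congr step; apply/seteqP.
by split=> t [b [bx <-]]; exists b, bx; rewrite fg.
Qed.

Lemma omega1_le_countable (a : omega1) :
  countable [set b | omega1_lt b a \/ b = a].
Proof.
rewrite -[X in countable X]/([set b | omega1_lt b a] `|` [set a]) -bigcup2E.
apply: bigcup_countable => // -[|[|n]] _ //=.
exact: omega1_lt_countable.
Qed.

Lemma omega1_countable_bounded (C : set omega1) : countable C ->
  exists d, forall a, C a -> omega1_lt a d.
Proof.
move=> cC; apply: contrapT => nd; apply: omega1_uncountable.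
apply: (@sub_countable _ _ _ (\bigcup_(a in C) [set b | omega1_lt b a \/ b = a])).
  apply: subset_card_le => d _; apply: contrapT => nCd; apply: nd; exists d => a Ca.
  have [//|ad|da] := omega1_lt_total a d.
    by exfalso; apply: nCd; exists a => //; right.
  by exfalso; apply: nCd; exists a => //; left.
apply: bigcup_countable => // a _; exact: omega1_le_countable.
Qed.

Lemma omega1_least (P : omega1 -> Prop) : (exists a, P a) ->
  exists a, P a /\ forall b, omega1_lt b a -> ~ P b.
Proof.
move=> [a]; elim/(well_founded_ind omega1_lt_wf): a => a IH Pa.
have [[b [ba Pb]]|nb] := pselect (exists b, omega1_lt b a /\ P b).
  exact: IH Pb.
by exists a; split=> // b ba Pb; apply: nb; exists b.
Qed.

(** * k-spaces of functions are countably tight *)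

Section CountableTightness.
Context (R : realType) (X : topologicalType) (H : set {ptws X -> R}).
Local Notation zero_set := (@zero_sets R X).

Lemma cluster_eval (G : set_system H) (f : H) (x : X) (r : R) : Filter G ->
  cluster G f -> set_val h x @[h --> G] --> r -> set_val f x = r.
Proof.
move=> FG cf Gr; apply: (@norm_hausdorff R R) => U V fU rV.
have [h [Vh Uh]] := cf _ _ (Gr V rV) (@eval_continuous _ _ H x f U fU).
by exists (set_val h x).
Qed.

Definition omega_closed (Y : topologicalType) (A : set Y) : Prop :=
  forall D, countable D -> D `<=` A -> closure D `<=` A.

(** Elements of [A `&` K] closer and closer to [y] on larger and larger finite
    parts of [E] have a cluster point in [K]; as it is in the closure of
    countably many elements of [A], it belongs to [A]. *)
Lemma compact_interpolation (A K : set H) (y : H) (E : set X) :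
  omega_closed A -> compact K -> closure (A `&` K) y -> countable E ->
  exists f, [/\ A f, K f & forall x, E x -> set_val f x = set_val y x].
Proof.
move=> oA cK cy /countable_injP[g ginj].
pose En n := E `&` [set x | (g x <= n)%N].
have fE n : finite_set (En n).
  apply: (@card_le_finite _ _ _ `I_n.+1); last exact: finite_II.
  have gEn : (g @` En n #= En n)%card.
    apply: inj_card_eq => u v /set_mem[Eu _] /set_mem[Ev _].
    by apply: ginj; exact: mem_set.
  rewrite -(card_le_eql gEn); apply: subset_card_le => _ [x [_ xn] <-].
  by rewrite /= ltnS.
have /choice[a aP] : forall n, exists a, [/\ A a, K a &
    close_on (En n) n (set_val a) (set_val y)].
  move=> n; have [a [Aa Ka] ca] := (closure_close_onP _ _).1 cy (En n) n (fE n).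
  by exists a.
have [f [Kf cf]] : exists f, K f /\ cluster (a @ \oo) f.
  by apply: cK; exists 0%N => // n _ /=; have [] := aP n.
exists f; split=> //.
  apply: (oA (range a)).
  - exact: countable_image.
  - by move=> _ [n _ <-]; have [] := aP n.
  - by move=> S fS; apply: cf => //; exists 0%N => // n _; exists n.
move=> x Ex; apply: (cluster_eval _ cf).
apply/cvgrPdist_lt => e e0.
have [N _ /= Ne] := near_infty_natSinv_lt (PosNum e0).
exists (maxn N (g x)) => // n /=; rewrite geq_max => /andP[Nn gn].
rewrite distrC; have [_ _ /(_ x (conj Ex gn)) ca] := aP n.
by apply: lt_trans ca _; exact: Ne.
Qed.

(** At stage [a], compact interpolation gives an f in [A `&` K] that agrees with
    [y] on the countably many points of the sets [F b] chosen before; as [A] is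
    closed under closures of countable sets, some basic neighbourhood of [y],
    given by [F a] and [k a], avoids all functions chosen before. *)
Lemma free_sequence (A K : set H) (y : H) :
  omega_closed A -> compact K -> closure (A `&` K) y -> ~ A y ->
  exists (f : omega1 -> H) (F : omega1 -> set X) (k : omega1 -> nat),
    [/\ forall a, K (f a),
        forall a, finite_set (F a),
        forall a b x, omega1_lt b a -> F b x -> set_val (f a) x = set_val y x
      & forall a b, omega1_lt b a ->
          ~ close_on (F a) (k a) (set_val (f b)) (set_val y)].
Proof.
move=> oA cK cy nAy.
have /choice[phi phiP] : forall E : set X, exists f : H, countable E ->
    [/\ A f, K f & forall x, E x -> set_val f x = set_val y x].
  move=> E; have [cE|nE] := pselect (countable E); last by exists y.
  by have [f fP] := compact_interpolation oA cK cy cE; exists f.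
have /choice[psi psiP] : forall D : set H, exists p : set X * nat,
    countable D -> D `<=` A -> finite_set p.1 /\
      forall f, D f -> ~ close_on p.1 p.2 (set_val f) (set_val y).
  move=> D; have [[cD DA]|nD] := pselect (countable D /\ D `<=` A); last first.
    by exists (set0, 0%N) => cD DA; exfalso; apply: nD.
  apply: contrapT => np; apply/nAy/(oA D) => //.
  apply/closure_close_onP => F k fF; apply: contrapT => nf; apply: np.
  by exists (F, k) => _ _; split=> // f Df cf; apply: nf; exists f.
(* [P] is the set of the triples (f b, F b, k b) chosen before. *)
pose step (P : set (H * (set X * nat))) :=
  (phi (\bigcup_(p in P) p.2.1), psi (fst @` P)).
have [p pE] := omega1_recursion step.
pose below a := [set b | omega1_lt b a].
have pP a : [/\ A (p a).1, K (p a).1, finite_set (p a).2.1,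
      forall b x, omega1_lt b a -> (p b).2.1 x -> set_val (p a).1 x = set_val y x
    & forall b, omega1_lt b a ->
        ~ close_on (p a).2.1 (p a).2.2 (set_val (p b).1) (set_val y)].
  elim/(well_founded_ind omega1_lt_wf): a => a IH.
  have [|pA pK py] := phiP (\bigcup_(q in p @` below a) q.2.1).
    apply: bigcup_countable; first exact/countable_image/omega1_lt_countable.
    by move=> _ [b ba <-]; have [_ _ + _ _] := IH b ba; exact: finite_set_countable.
  have [||pF npc] := psiP (fst @` (p @` below a)).
  - exact/countable_image/countable_image/omega1_lt_countable.
  - by move=> _ [_ [b ba <-] <-]; have [] := IH b ba.
  rewrite pE; split=> //=.
  - by move=> b x ba Fx; apply: py; exists (p b) => //; exists b.
  - by move=> b ba; apply: npc; exists (p b) => //; exists b.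
exists (fun a => (p a).1), (fun a => (p a).2.1), (fun a => (p a).2.2).
split=> [a|a|a b x ba|a b ba]; have [_ pK pF py pc] := pP a => //.
- exact: py.
- exact: pc.
Qed.

Context (sH : stable_baire_one R X `<=` H).
Context (Hlc : forall h : H, zero_locally_constant (set_val h)).

(** The coloring [c] of finite sets by the first index that works is locally
    finite: around each point of a finite set [E] there is a zero-set on which
    the countably many functions [f b], b <= c E, and [y] are constant.  On the
    union of these zero-sets, a finite set has the same color as the
    set of the points of [E] to which its elements are attached. *)
Lemma k_space_countable_first_index (f : omega1 -> H) (y : H) (m : nat)
    (c : set X -> omega1) :
  k_space H ->
  (forall E, finite_set E -> close_on E m (set_val (f (c E))) (set_val y)) ->
  (forall E b, finite_set E -> omega1_lt b (c E) ->
    ~ close_on E m (set_val (f b)) (set_val y)) ->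
  countable (colors c setT).
Proof.
move=> kH cc cmin; apply: (k_space_countable_colors sH) => // E fE.
have /choice[C CP] : forall p : H * X, exists W : set X,
    [/\ zero_set W, W p.2 & forall z, W z -> set_val p.1 z = set_val p.1 p.2].
  by move=> p; exact: Hlc.
pose B := [set b | omega1_lt b (c E) \/ b = c E].
pose D := y |` (f @` B).
have cD : countable D.
  rewrite /D -bigcup2E; apply: bigcup_countable => // -[|[|n]] _ //=.
  exact/countable_image/omega1_le_countable.
pose W x := \bigcap_(h in D) C (h, x).
have WD x z h : W x z -> D h -> set_val h z = set_val h x.
  by move=> Wz Dh; have [_ _] := CP (h, x); apply; exact: Wz.
exists (\bigcup_(x in E) W x); split.
- apply: zero_set_bigcup => // x _; apply: zero_set_bigcap => // h _.
  by have [] := CP (h, x).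
- by move=> x Ex; exists x => // h _; have [] := CP (h, x).
apply: (@sub_finite_set _ _ (c @` [set G | G `<=` E])); last first.
  exact/finite_image/finite_subsets.
move=> _ [G' [fG' G'W] <-].
pose G := E `&` [set x | exists2 z, G' z & W x z].
have GE : G `<=` E by move=> x [].
have fG : finite_set G by exact: sub_finite_set GE fE.
have Dy : D y by left.
have Df b : B b -> D (f b) by move=> Bb; right; exists b.
have close_onGG' b : B b -> close_on G' m (set_val (f b)) (set_val y) <->
    close_on G m (set_val (f b)) (set_val y).
  move=> /Df Db; split=> [cG' x [_ [z G'z Wz]]|cG z G'z].
    by rewrite -(WD x z) // -(WD x z y) //; exact: cG'.
  have [x Ex Wz] := G'W z G'z.
  by rewrite (WD x z) // (WD x z y) //; apply: cG; split=> //; exists z.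
have B_of a : ~ omega1_lt (c E) a -> B a.
  by have [h|->|h] := omega1_lt_total a (c E) => //; [left|right].
have BG' : B (c G').
  apply: B_of => lt; apply: (cmin G' (c E)) => //; apply/close_onGG'; first by right.
  by move=> x /GE; exact: cc.
have BG : B (c G).
  apply: B_of => lt; apply: (cmin G (c E)) => // x /GE; exact: cc.
exists G => //.
have [lt|//|lt] := omega1_lt_total (c G) (c G').
- by exfalso; apply: (cmin G' (c G)) => //; apply/close_onGG' => //; exact: cc.
- by exfalso; apply: (cmin G (c G')) => //; apply/close_onGG' => //; exact: cc.
Qed.

(** The limit [y'] of the free sequence agrees with [y] on every [F b].  Each
    finite set E and each precision m have a first index [c (m, E)] at which the
    sequence is close to [y'] on E; these indices being bounded by some [d], the
    one for [F d] and [k d] contradicts the choice of [F d] and [k d]. *)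
Lemma k_space_omega_closed (A : set H) : k_space H -> omega_closed A -> closed A.
Proof.
move=> kH oA; apply: contrapT => nA.
have [K [y [cK Ky cy nAy]]] := k_space_limit kH nA.
have [f [F [k [fK fF fy nf]]]] := free_sequence oA cK cy nAy.
have gt_ex d : exists a, omega1_lt d a.
  by have [a aP] := omega1_countable_bounded (countable1 d); exists a; exact: aP.
have [d0 _] := omega1_countable_bounded (countable0 omega1).
pose G : set_system H := [set S | exists d, forall a, omega1_lt d a -> S (f a)].
have PG : ProperFilter G.
  split; first by move=> [d /= dP]; have [a /dP] := gt_ex d.
  split; first by exists d0.
  - move=> S T [d dS] [e eT].
    have [m mP] := @omega1_countable_bounded [set d; e]
      (finite_set_countable (finite_set2 d e)).
    exists m => a ma; split; [apply: dS|apply: eT].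
      by apply: (omega1_lt_trans _ ma); apply: mP; left.
    by apply: (omega1_lt_trans _ ma); apply: mP; right.
  - by move=> S T ST [d dS]; exists d => a /dS; exact: ST.
have [y' [_ cy']] : exists y', K y' /\ cluster G y'.
  by apply: cK; exists d0 => a _; exact: fK.
have y'E b x : F b x -> set_val y' x = set_val y x.
  move=> Fx; apply: (cluster_eval _ cy'); apply: cvg_near_cst.
  by exists b => a ba; exact: (fy a b x ba Fx).
have /choice[c cP] : forall p : nat * set X, exists a, finite_set p.2 ->
    close_on p.2 p.1 (set_val (f a)) (set_val y') /\
    forall b, omega1_lt b a -> ~ close_on p.2 p.1 (set_val (f b)) (set_val y').
  move=> [m E]; have [fE|nfE] := pselect (finite_set E); last by exists d0.
  have : G (range f) by exists d0 => a _; exists a.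
  move=> /cy' /(_ (near_close_on y' m fE))[_ [[a _ <-] ca]].
  have [b [cb bmin]] := @omega1_least
    (fun a => close_on E m (set_val (f a)) (set_val y')) (ex_intro _ a ca).
  by exists b.
have cC : countable (\bigcup_m colors (fun E => c (m, E)) setT).
  apply: bigcup_countable => // m _.
  apply: (@k_space_countable_first_index f y' m) => // E.
    by move=> fE; exact: (cP (m, E) fE).1.
  by move=> b fE; exact: (cP (m, E) fE).2.
have [d dP] := omega1_countable_bounded cC.
apply: (nf d (c (k d, F d))).
  by apply: dP; exists (k d) => //; exists (F d).
by move=> x Fx; rewrite -(y'E d x Fx); exact: (cP (k d, F d) (fF d)).1.
Qed.

Lemma k_space_countably_tight : k_space H -> countably_tight H.
Proof.
move=> kH A a cAa.
(* The closures of the countable subsets of [A] together form a set to which the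
   preceding lemma applies. *)
pose A' := [set b | exists B : set H, [/\ B `<=` A, countable B & closure B b]].
suff clA' : closed A'.
  apply: clA'; apply: closureS cAa => b Ab; exists [set b]; split=> //.
    by move=> _ ->.
  exact: subset_closure.
apply: k_space_omega_closed => // D cD DA' b cb.
have /choice[B BP] : forall d, exists B : set H, D d ->
    [/\ B `<=` A, countable B & closure B d].
  move=> d; have [/DA'[B BP]|nD] := pselect (D d); first by exists B.
  by exists set0.
exists (\bigcup_(d in D) B d); split.
- by move=> z [d /BP[BA _ _] /BA].
- by apply: bigcup_countable => // d /BP[].
- apply: closed_closure; apply: closureS cb => d Dd.
  have [_ _] := BP d Dd; apply: closureS => z Bz; by exists d.
Qed.

End CountableTightness.

(** * Countable tightness and the property gamma *)

Section BetweenStableAndBaire.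
Context (R : realType) (X : topologicalType) (H : set {ptws X -> R}).
Local Notation zero_set := (@zero_sets R X).
Context (sH : stable_baire_one R X `<=` H).
Context (Hlc : forall h : H, zero_locally_constant (set_val h)).

Lemma countably_tight_omega_lindelof :
  countably_tight H -> omega_lindelof (aleph0_space R X).
Proof.
move=> tH U oU cU.
pose A : set H := [set h | exists W V, [/\ zero_set W, U V, W `<=` V
  & forall x, set_val h x = if x \in W then 1 else 0]].
have [e eE] := two_valued_ex sH 1 1 (zero_setT R X).
have e1 x : set_val e x = 1 by rewrite eE; case: ifP.
have cAe : closure A e.
  apply/closure_close_onP => F k fF; have [V UV FV] := cU F fF.
  have /choice[W WP] : forall x, exists W : set X,
      F x -> [/\ zero_set W, W x & W `<=` V].
    move=> x; have [Fx|nFx] := pselect (F x); last by exists setT.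
    by have [W WP] := open_zero_set (oU V UV) (FV x Fx); exists W.
  have zW : zero_set (\bigcup_(x in F) W x).
    by apply: zero_set_bigcup => // x /WP[].
  have [h hE] := two_valued_ex sH 1 0 zW; exists h.
    exists (\bigcup_(x in F) W x), V; split=> //.
    by move=> z [x /WP[_ _ WV] /WV].
  move=> x Fx; rewrite e1 hE ifT ?subrr ?normr0 ?invr_gt0 //.
  by apply/mem_set; exists x => //; have [] := WP x Fx.
have [B [BA /countable_injP[g ginj] cBe]] := tH A e cAe.
have [b0 [Bb0 _]] := cBe setT filterT.
have /choice[b bP] : forall n, exists b, B b /\ forall h, B h -> g h = n -> h = b.
  move=> n; have [[h [Bh gh]]|nh] := pselect (exists h, B h /\ g h = n).
    exists h; split=> // h' Bh' gh'.
    by apply: ginj; rewrite ?gh //; exact: mem_set.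
  by exists b0; split=> // h Bh gh; exfalso; apply: nh; exists h.
have /choice[V VP] : forall n, exists V, U V /\
    forall x, set_val (b n) x != 0 -> V x.
  move=> n; have [/BA[W [V [_ UV WV bE]]] _] := bP n; exists V; split=> // x.
  by rewrite bE; case: ifP => [/set_mem/WV//|_]; rewrite eqxx.
exists V; split=> [n|F fF]; first exact: (VP n).1.
have [h Bh ch] := (closure_close_onP _ _).1 cBe F 0%N fF.
exists (V (g h)) => [|x Fx]; first by exists (g h).
apply: (VP (g h)).2; rewrite -((bP (g h)).2 h Bh erefl).
apply/eqP => hx; have := ch x Fx.
by rewrite e1 hx sub0r normrN normr1 invr1 ltxx.
Qed.

Lemma locally_constant_open (f g : H) (P : R -> R -> Prop) :
  open ([set x | P (set_val f x) (set_val g x)] : set (aleph0_space R X)).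
Proof.
rewrite openE => x Pfg.
have [V [zV Vx fV]] := Hlc f x; have [W [zW Wx gW]] := Hlc g x.
have VWx : nbhs (x : aleph0_space R X) (V `&` W).
  apply: open_nbhs_nbhs; split=> //.
  by apply: (@openI (aleph0_space R X)); exact: zero_set_open.
apply: (@filterS _ (nbhs (x : aleph0_space R X)) _ (V `&` W)) => // z [Vz Wz] /=.
by rewrite fV // gW.
Qed.

Lemma property_gamma_frechet_urysohn :
  property_gamma (aleph0_space R X) -> frechet_urysohn H.
Proof.
move=> /property_gamma_omega_lindelof LX A a cAa.
pose U n (f : {h | A h}) : set (aleph0_space R X) :=
  [set x | `|set_val (sval f) x - set_val a x| < n.+1%:R^-1].
have [||s sP] := @omega_cover_selection _ _ U (@aleph0_p_space R X) LX.
- by move=> n f; exact: (locally_constant_open _ _ (fun r t => `|r - t| < _)).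
- move=> n F fF; have [f Af cf] := (closure_close_onP _ _).1 cAa F n fF.
  exists (U n (exist _ f Af)); first by exists (exist _ f Af).
  exact: cf.
exists (fun n => sval (s n)); split=> [n|]; first exact: svalP.
apply: cvg_pointwiseP => x k; have [N _ NP] := sP x.
exists (maxn N k) => // n /=; rewrite geq_max => /andP[Nn kn] _ ->.
apply: lt_le_trans (NP n Nn) _.
by rewrite lef_pV2 ?posrE // ler_nat.
Qed.

End BetweenStableAndBaire.

(** * The equivalence *)

Theorem corollary5p21 (R : realType) (X : topologicalType)
    (H : set {ptws X -> R}) :
  tychonoff_space X ->
  H `<=` baire_functions R X ->
  stable_baire_one R X `<=` H ->
  [<-> frechet_urysohn H;
       sequential H;
       k_space H;
       countably_tight H;
       property_gamma (aleph0_space R X)].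
Proof.
move=> _ HB sH.
have Hlc (h : H) : zero_locally_constant (set_val h).
  exact/baire_locally_constant/HB/set_valP.
tfae.
- exact: frechet_urysohn_sequential.
- exact: sequential_k_space.
- exact: k_space_countably_tight.
- move=> /(countably_tight_omega_lindelof sH).
  exact/omega_lindelof_property_gamma/aleph0_p_space.
- exact: property_gamma_frechet_urysohn.
Qed.
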